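(* Let $g$ be a connected social network on $N=\{1,\dots,n\}$ (not necessarily completely informative). An ex post incentive-compatible and ex post efficient direct mechanism exists if and only if for every pair of linked individuals $(i,j)$ (i.e. $g_{ij}=1$) there exists a third individual $k$ who observes both $i$ and $j$, i.e. $g_{ik}g_{jk}=1$.
   Context: Setting. $N=\{1,\dots,n\}$ is a set of individuals and $g$ is a connected, undirected simple graph on $N$ (the social network), commonly known; $g_{ij}=1$ if $i,j$ are linked (friends), $g_{ij}=0$ otherwise. Each individual $i$ has a real characteristic $\theta_i$; a realization is a vector $(\theta_1,\dots,\theta_n)$ with pairwise distinct entries. Individual $i$ observes the ordinal comparison between distinct $j$ and $k$ if and only if each of $j,k$ is either $i$ himself or a friend of $i$ in $g$. Types. Individual $i$'s type is a matrix $T^i=[t^i_{jk}]$ with $t^i_{jk}\in\{-1,0,1\}$, $t^i_{jk}=-t^i_{kj}$, and $t^i_{jk}\neq 0$ if and only if $i$ observes the comparison between $j$ and $k$; $t^i_{jk}=1$ means $\theta_j>\theta_k$ and $t^i_{jk}=-1$ means $\theta_j<\theta_k$. Any matrix of this form may be reported by $i$. A vector of (true) types is a profile ${\bf T}=(T^1,\dots,T^n)$ generated by some realization $(\theta_1,\dots,\theta_n)$. Induced order. For a vector of types ${\bf T}$, write $i\succ_{\bf T} j$ if there is $k$ with $t^k_{ij}=1$, or there are individuals $i=i^0,\dots,i^M=j$ and $k^0,\dots,k^{M-1}$ with $t^{k^m}_{i^m i^{m+1}}=1$ for all $m=0,\dots,M-1$. This is a partial order, possibly incomplete. The network $g$ is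 completely informative if $\succ_{\bf T}$ is a total ranking of $N$ for every realization. Mechanisms. A direct mechanism assigns to every vector of reported matrices a complete ranking $\rho$ of $N$, i.e. a bijection $i\mapsto\rho_i\in\{1,\dots,n\}$. Individuals care only about their own rank and strictly prefer higher $\rho_i$ (rank $1$ is worst). The mechanism is ex post incentive compatible if for every individual $i$, every vector of types ${\bf T}=(T^i,T^{-i})$ and every report $T'^i$ of $i$, $\rho_i({\bf T})\ge\rho_i(T'^i,T^{-i})$. It is ex post efficient if for every vector of types ${\bf T}$ and all $i,j$, $i\succ_{\bf T} j$ implies $\rho_i({\bf T})>\rho_j({\bf T})$. *)

(* Defs.v *)
From HB Require Import structures.
From mathcomp Require Import all_boot all_order all_algebra all_fingroup.
From mathcomp Require Import reals.

Set Implicit Arguments.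
Unset Strict Implicit.
Unset Printing Implicit Defensive.

Import Order.TTheory GRing.Theory Num.Theory.
Local Open Scope ring_scope.

Section Types.
Variables (n : nat) (g : rel 'I_n).

Definition observes (i j k : 'I_n) : bool :=
  [&& j != k, (j == i) || g i j & (k == i) || g i k].

(* No transitivity is required: a report may be cyclic. *)
Definition admissible (i : 'I_n) (t : 'M[int]_n) : bool :=
  [forall j, forall k,
    [&& t j k \in [:: -1; 0; 1], t j k == - t k j
      & (t j k != 0) == observes i j k]].

Definition report (i : 'I_n) : Type := {t : 'M[int]_n | admissible i t}.

Definition profile : Type := {dffun forall i : 'I_n, report i}.

(* The profile (T'^i, T^{-i}). *)
Definition deviate (T : profile) (i : 'I_n) (Ti' : report i) : profile :=
  [ffun j => dfwith T Ti' j].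

(* [sgz] is the int-valued sign; unobserved entries are already 0. *)
Definition generated_by (R : realType) (theta : 'I_n -> R) (T : profile) :
    Prop :=
  forall i j k, observes i j k -> val (T i) j k = sgz (theta j - theta k).

Definition type_vector (R : realType) (T : profile) : Prop :=
  exists2 theta : 'I_n -> R, injective theta & generated_by theta T.

Definition reported_above (T : profile) : rel 'I_n :=
  fun i j => [exists k, val (T k) i j == 1].

(* A chain i = i^0, ..., i^M = j with M >= 1; [p] lists the intermediate
   individuals, and [p = [::]] is the direct comparison. *)
Definition induced_order (T : profile) (i j : 'I_n) : Prop :=
  exists p : seq 'I_n, path (reported_above T) i (rcons p j).

Definition mechanism : Type := profile -> {perm 'I_n}.

(* Ordinals start at 0, ranks at 1 (the worst). *)
Definition rank (rho : mechanism) (T : profile) (i : 'I_n) : nat :=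
  (rho T i).+1.

Definition ex_post_IC (R : realType) (rho : mechanism) : Prop :=
  forall T : profile, type_vector R T ->
  forall (i : 'I_n) (Ti' : report i),
    (rank rho (deviate T Ti') i <= rank rho T i)%N.

Definition ex_post_efficient (R : realType) (rho : mechanism) : Prop :=
  forall T : profile, type_vector R T ->
  forall i j : 'I_n, induced_order T i j -> (rank rho T j < rank rho T i)%N.

End Types.

(* Main.v *)
(* Necessity.  Let [i] and [j] be linked without a common friend.  Take two
   realizations that differ by exchanging [i] and [j], the two lowest values,
   everyone else having a lower friend; then only [i] and [j] see a difference.
   The lowest individual ([i], resp. [j]) is pinned to rank 1, and when he
   reports his type from the other realization, the same profile of reports
   arises in both cases.  There both [i] and [j] would have rank 1.

   Sufficiency.  A link is seen by three people, so a majority vote decides it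
   whatever a single deviator says; a pair of unlinked individuals with a common
   friend is decided by one such friend, the relay.  Rank by the finishing order
   of a depth-first search that goes from higher to lower individuals and
   visits, from each individual, his friends before the friends of friends.  A
   deviation of [i] only affects the relayed part of the lists of friends above
   [i], which is read after [i] is finished since [i] is one of their friends,
   and the lists of individuals below [i], who in truth all finish before [i].
   Hence the individuals that are not below [i] and finish before [i] are
   unchanged, and [i] cannot gain. *)

Require Import Defs.
From HB Require Import structures.
From mathcomp Require Import all_boot all_order all_algebra all_fingroup.
From mathcomp Require Import reals.

Set Implicit Arguments.
Unset Strict Implicit.
Unset Printing Implicit Defensive.

Import Order.TTheory GRing.Theory Num.Theory.

(** * Depth-first search on a finite type and its list of finished vertices *)

Section Postorder.
Variable T : finType.
Implicit Types (ch : T -> seq T) (anc v s : seq T).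

Lemma foldl_ind (S : Type) (P : S -> Prop) (f : S -> T -> S) z (l : seq T) :
  (forall z' c, c \in l -> P z' -> P (f z' c)) -> P z -> P (foldl f z l).
Proof.
elim: l z => //= c l IHl z Pf Pz; apply: IHl; last exact/Pf/Pz/mem_head.
by move=> z' y yl; apply: Pf; rewrite inE yl orbT.
Qed.

(* [anc] is the stack of open vertices and [v] the list of finished ones; [n]
   is fuel, which never runs out as long as [size anc + n = #|T|]. *)
Fixpoint finish ch n anc v x : seq T :=
  if (x \in anc) || (x \in v) then v else
  if n is m.+1 then rcons (foldl (finish ch m (x :: anc)) v (ch x)) x else v.

Definition postorder ch : seq T := foldl (finish ch #|T| [::]) [::] (enum T).

(** Only descendants of [x] are appended, so they inherit any [P] closed under [ch]. An open vertex
    is never reopened, whence the last clause. The fuel plays no part, so the claim holds for every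
    [n]. *)
Lemma finish_cat ch (P : pred T) n anc v x :
    (forall y z, P y -> z \in ch y -> P z) -> P x ->
  exists s, [/\ finish ch n anc v x = v ++ s, {subset s <= P} &
                {in s, forall y, y \notin anc}].
Proof.
move=> closP; elim: n anc v x => [|n IHn] anc v x Px /=.
  by exists [::]; rewrite cats0; split=> //; case: ifP.
case: ifP => [_|/norP[x_anc _]]; first by exists [::]; rewrite cats0.
have [s [-> sP ns]]: exists s,
    [/\ foldl (finish ch n (x :: anc)) v (ch x) = v ++ s, {subset s <= P} &
        {in s, forall y, y \notin anc}].
  apply: (foldl_ind (P := fun w => exists s,
    [/\ w = v ++ s, {subset s <= P} & {in s, forall y, y \notin anc}])).
    move=> _ c cx [s [-> sP ns]].
    have [s' [-> s'P ns']] := IHn (x :: anc) (v ++ s) c (closP x c Px cx).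
    exists (s ++ s'); rewrite catA; split=> // y; rewrite mem_cat.
      by case/orP => [/sP|/s'P].
    by case/orP => [/ns //|/ns']; rewrite inE => /norP[].
  by exists [::]; rewrite cats0.
exists (rcons s x); rewrite rcons_cat; split=> // y; rewrite mem_rcons inE.
  by case/orP => [/eqP->|/sP].
by case/orP => [/eqP->|/ns].
Qed.

Lemma foldl_finish_cat ch (P : pred T) n anc v l :
    (forall y z, P y -> z \in ch y -> P z) -> {subset l <= P} ->
  exists s, [/\ foldl (finish ch n anc) v l = v ++ s, {subset s <= P} &
                {in s, forall y, y \notin anc}].
Proof.
move=> closP lP; apply: (foldl_ind (P := fun w => exists s,
  [/\ w = v ++ s, {subset s <= P} & {in s, forall y, y \notin anc}])).
  move=> _ c cl [s [-> sP ns]].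
  have [s' [-> s'P ns']] := finish_cat n anc (v ++ s) closP (lP c cl).
  exists (s ++ s'); rewrite catA; split=> // y; rewrite mem_cat.
    by case/orP => [/sP|/s'P].
  by case/orP => [/ns|/ns'].
by exists [::]; rewrite cats0.
Qed.

Lemma foldl_finish_prefix ch n anc v l :
  exists s, foldl (finish ch n anc) v l = v ++ s /\
            {in s, forall y, y \notin anc}.
Proof.
by have [//|//|s [-> _ ns]] := @foldl_finish_cat ch predT n anc v l; exists s.
Qed.

Lemma sub_foldl_finish ch n anc v l : {subset v <= foldl (finish ch n anc) v l}.
Proof.
by have [s [-> _]] := foldl_finish_prefix ch n anc v l => y yv; rewrite mem_cat yv.
Qed.

Lemma finish_uniq ch n anc v x : uniq v -> uniq (finish ch n anc v x).
Proof.
elim: n anc v x => [|n IHn] anc v x /= uv; first by case: ifP.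
case: ifP => // /norP[x_anc x_v].
rewrite rcons_uniq; apply/andP; split.
  have [s [-> ns]] := foldl_finish_prefix ch n (x :: anc) v (ch x).
  rewrite mem_cat (negPf x_v) /=; apply/negP => /ns.
  by rewrite inE eqxx.
by apply: (foldl_ind (P := fun w => uniq w)) uv => v' c _; apply: IHn.
Qed.

Lemma postorder_uniq ch : uniq (postorder ch).
Proof. by apply: (foldl_ind (P := fun w => uniq w)) => // v' c _; apply: finish_uniq. Qed.

Definition fuel_for n anc := uniq anc && (size anc + n == #|T|).

Lemma fuel_for_cons n anc x : x \notin anc -> fuel_for n.+1 anc ->
  fuel_for n (x :: anc).
Proof. by rewrite /fuel_for /= addSnnS => -> /andP[-> ->]. Qed.

(** With no fuel left the duplicate-free stack has size [#|T|], so it already contains every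
    vertex. *)
Lemma fuel_for0 anc x : x \notin anc -> fuel_for 0 anc = false.
Proof.
move=> x_anc; apply/negP => /andP[u /eqP]; rewrite addn0 => sz.
have: uniq (x :: anc) by rewrite /= x_anc.
move/card_uniqP => /= cxa; have := max_card (mem (x :: anc)).
by rewrite cxa sz ltnn.
Qed.

Lemma mem_finish ch n anc v x : fuel_for n anc -> x \notin anc ->
  x \in finish ch n anc v x.
Proof.
case: n => [|n] f x_anc; first by rewrite (fuel_for0 x_anc) in f.
rewrite /= (negPf x_anc) /=; case: ifP => // _.
by rewrite mem_rcons mem_head.
Qed.

Lemma mem_foldl_finish ch n anc v l x : fuel_for n anc -> x \notin anc ->
  x \in l -> x \in foldl (finish ch n anc) v l.
Proof.
move=> f x_anc; elim: l v => //= c l IHl v; rewrite inE => /orP[/eqP<-|/IHl//].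
exact/sub_foldl_finish/mem_finish.
Qed.

Lemma mem_postorder ch x : x \in postorder ch.
Proof. by apply: mem_foldl_finish; rewrite ?mem_enum // /fuel_for /= add0n. Qed.

Lemma size_postorder ch : size (postorder ch) = #|T|.
Proof.
rewrite -(card_uniqP (postorder_uniq ch)); apply: eq_card => x.
by rewrite mem_postorder inE.
Qed.

(** * Topological order of the finished vertices in the acyclic case *)

Section Topological.
Variables (ch : T -> seq T) (lt : rel T).
Hypotheses (lt_irr : irreflexive lt) (lt_tr : transitive lt).
Hypothesis ch_lt : forall y z, z \in ch y -> lt z y.

Definition topological s :=
  forall y z, y \in s -> z \in ch y -> index z s < index y s.

Lemma topological_rcons s x : topological s -> x \notin s ->
  {subset ch x <= s} -> topological (rcons s x).
Proof.
move=> tops x_s chx y z; rewrite mem_rcons inE -cats1 !index_cat.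
case: (eqVneq y x) => [-> _ /chx zs|_ /= ys zy].
  by rewrite (negPf x_s) zs /= eqxx addn0 index_mem.
have lt_zy := tops y z ys zy.
by rewrite -index_mem (ltn_trans lt_zy) ?index_mem ys.
Qed.

(** All open vertices are [lt]-above [x], so no child of [x] is open. Each child is therefore
    finished before [x] is appended. *)
Lemma finish_topological n anc v x : fuel_for n anc ->
  {in anc, forall a, lt x a} -> topological v ->
  topological (finish ch n anc v x).
Proof.
elim: n anc v x => [|n IHn] anc v x f x_lt topv /=; first by case: ifP.
case: ifP => // /norP[x_anc x_v].
have f' := fuel_for_cons x_anc f.
have c_lt c a : c \in ch x -> a \in x :: anc -> lt c a.
  move=> /ch_lt cx; rewrite inE => /orP[/eqP->//|/x_lt]; exact: lt_tr.
have c_anc c : c \in ch x -> c \notin x :: anc.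
  by move=> cx; apply/negP => /(c_lt _ _ cx); rewrite lt_irr.
apply: topological_rcons.
- by apply: (foldl_ind (P := topological)) topv => v' c cx; apply: IHn => // a; apply: c_lt.
- have [s [-> ns]] := foldl_finish_prefix ch n (x :: anc) v (ch x).
  rewrite mem_cat (negPf x_v) /=; apply/negP => /ns.
  by rewrite inE eqxx.
- by move=> c cx; apply: mem_foldl_finish => //; apply: c_anc.
Qed.

Lemma postorder_topological : topological (postorder ch).
Proof.
have f : fuel_for #|T| [::] by rewrite /fuel_for /= add0n.
by apply: (foldl_ind (P := topological)) => // v' c _; apply: finish_topological.
Qed.

End Topological.

(** * Comparison of two searches up to the moment when [i] is finished *)

Section Coupling.
Variables (D : pred T) (i : T) (ch ch' : T -> seq T).
Hypotheses (iD : ~~ D i)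
  (clos : forall y z, D y -> z \in ch y -> D z)
  (clos' : forall y z, D y -> z \in ch' y -> D z)
  (chi : forall z, z \in ch i -> D z)
  (chi' : forall z, z \in ch' i -> D z).
(** Two lists may differ only behind a common prefix containing [i]: by the time the tails are read,
    [i] is finished. *)
Hypothesis agree : forall t, t != i -> ~~ D t -> ch t = ch' t \/
  exists l m m', [/\ ch t = l ++ m, ch' t = l ++ m' & i \in l].

(** While [i] is unfinished, [index i s] is [size s], so nothing is truncated; once [i] is in the
    list, its cut is frozen. *)
Definition cut s := [seq y <- take (index i s) s | ~~ D y].

Definition same_cut v v' := (i \in v) = (i \in v') /\ cut v = cut v'.

Lemma cut_cat v s : i \in v -> cut (v ++ s) = cut v.
Proof. by move=> iv; rewrite /cut index_cat iv takel_cat // index_size. Qed.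

Lemma cut_notin v : i \notin v -> cut v = [seq y <- v | ~~ D y].
Proof. by move=> iv; rewrite /cut memNindex // take_size. Qed.

Lemma cut_catD v s : i \notin v -> {subset s <= D} -> cut (v ++ s) = cut v.
Proof.
move=> iv sD; have is_ : i \notin s by apply/negP => /sD; apply/negP.
rewrite !cut_notin ?mem_cat ?negb_or ?iv // filter_cat.
rewrite -[RHS]cats0; congr (_ ++ _); apply/eqP.
by rewrite -[_ == _]negbK -has_filter; apply/hasPn => y /sD yD; rewrite negbK.
Qed.

Lemma same_cut_cat v v' s s' : i \in v -> same_cut v v' ->
  same_cut (v ++ s) (v' ++ s').
Proof.
move=> iv [iE vE]; have iv' : i \in v' by rewrite -iE.
by split; rewrite ?mem_cat ?iv ?iv' // !cut_cat.
Qed.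

Lemma same_cut_catD v v' s s' : {subset s <= D} -> {subset s' <= D} ->
  same_cut v v' -> same_cut (v ++ s) (v' ++ s').
Proof.
move=> sD sD' eq_v; have [iv|iv] := boolP (i \in v); first exact: same_cut_cat.
have [iE vE] := eq_v; have iv' : i \notin v' by rewrite -iE.
split; last by rewrite !cut_catD.
have iD' (w : seq T) : {subset w <= D} -> (i \in w) = false.
  by move=> wD; apply/negP => /wD; apply/negP.
by rewrite !mem_cat (iD' _ sD) (iD' _ sD') iE.
Qed.

Lemma same_cut_rcons v v' x : ~~ D x -> same_cut v v' ->
  same_cut (rcons v x) (rcons v' x).
Proof.
move=> Dx eq_v; rewrite -!cats1.
have [iv|iv] := boolP (i \in v); first exact: same_cut_cat.
have [iE vE] := eq_v; have iv' : i \notin v' by rewrite -iE.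
split; first by rewrite !mem_cat iE.
have [<-|neq_ix] := eqVneq i x.
  rewrite /cut !index_cat (negPf iv) (negPf iv') /= eqxx !addn0 !take_size_cat //.
  by rewrite -!cut_notin.
have cutx w : i \notin w -> cut (w ++ [:: x]) = rcons (cut w) x.
  move=> iw; rewrite !cut_notin // ?mem_cat ?inE ?negb_or ?iw //.
  by rewrite filter_cat /= Dx cats1.
by rewrite !cutx // vE.
Qed.

(** The searches run in lockstep outside [D]. Inside [D] they may diverge, but then they append only
    elements of [D], which [cut] ignores; after [i] is finished any divergence is harmless. *)
Lemma finish_same_cut n anc v v' x : fuel_for n anc -> i \notin anc ->
  same_cut v v' -> same_cut (finish ch n anc v x) (finish ch' n anc v' x).
Proof.
elim: n anc v v' x => [|n IHn] anc v v' x f i_anc eq_v.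
  by rewrite /=; do 2 case: ifP.
have [iv|iv] := boolP (i \in v).
  have [s [-> _ _]] := @finish_cat ch predT n.+1 anc v x (fun _ _ _ _ => isT) isT.
  have [s' [-> _ _]] := @finish_cat ch' predT n.+1 anc v' x (fun _ _ _ _ => isT) isT.
  exact: same_cut_cat.
have [Dx|Dx] := boolP (D x).
  have [s [-> sD _]] := finish_cat n.+1 anc v clos Dx.
  have [s' [-> sD' _]] := finish_cat n.+1 anc v' clos' Dx.
  exact: same_cut_catD.
(* Since [i] is unfinished, the cuts list all finished vertices outside [D], so both searches skip
   [x] or both visit it. *)
have xE : (x \in v) = (x \in v').
  have [iE vE] := eq_v; have iv' : i \notin v' by rewrite -iE.
  by move: vE; rewrite !cut_notin // => /(congr1 (fun s => x \in s));
     rewrite !mem_filter Dx.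
rewrite /= -xE; case: ifP => // /norP[x_anc _]; apply: same_cut_rcons => //.
have f' := fuel_for_cons x_anc f.
have [->|neq_xi] := eqVneq x i.
  have [s [-> sD _]] := foldl_finish_cat n (i :: anc) v clos chi.
  have [s' [-> sD' _]] := foldl_finish_cat n (i :: anc) v' clos' chi'.
  exact: same_cut_catD.
have i_xanc : i \notin x :: anc by rewrite inE negb_or eq_sym neq_xi.
have eq_foldl l w w' : same_cut w w' ->
    same_cut (foldl (finish ch n (x :: anc)) w l)
             (foldl (finish ch' n (x :: anc)) w' l).
  by elim: l w w' => //= c l IHl w w' eq_w; apply/IHl/IHn.
have [<-|[l [m [m' [-> -> il]]]]] := agree neq_xi Dx; first exact: eq_foldl.
rewrite !foldl_cat.
have [s [-> _]] := foldl_finish_prefix ch n (x :: anc)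
  (foldl (finish ch n (x :: anc)) v l) m.
have [s' [-> _]] := foldl_finish_prefix ch' n (x :: anc)
  (foldl (finish ch' n (x :: anc)) v' l) m'.
(* The prefix [l] has finished [i], so what [m] and [m'] append is irrelevant. *)
apply: same_cut_cat; last exact: eq_foldl.
exact: mem_foldl_finish.
Qed.

Lemma postorder_same_cut : cut (postorder ch) = cut (postorder ch').
Proof.
have f : fuel_for #|T| [::] by rewrite /fuel_for /= add0n.
have eq_foldl l w w' : same_cut w w' ->
    same_cut (foldl (finish ch #|T| [::]) w l)
             (foldl (finish ch' #|T| [::]) w' l).
  by elim: l w w' => //= c l IHl w w' eq_w; apply/IHl/finish_same_cut.
by have [] := eq_foldl (enum T) [::] [::] (conj erefl erefl).
Qed.

(** The position of [i] is the size of the cut, common to both searches, plus the number of elements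
    of [D] before [i]. Under [ch] all of [D] comes before [i], so this number is already maximal. *)
Lemma index_postorder_le :
  {in D, forall y, index y (postorder ch) < index i (postorder ch)} ->
  index i (postorder ch') <= index i (postorder ch).
Proof.
move=> Dlt.
have sizeE (s : seq T) : i \in s ->
    index i s = count D (take (index i s) s) + size (cut s).
  move=> is_; rewrite size_filter count_predC size_takel //.
  exact: index_size.
rewrite [leqLHS]sizeE ?mem_postorder // [leqRHS]sizeE ?mem_postorder //.
rewrite postorder_same_cut leq_add2r -!size_filter.
apply: uniq_leq_size; first exact/filter_uniq/take_uniq/postorder_uniq.
move=> y; rewrite !mem_filter => /andP[Dy _]; rewrite Dy /=.
by rewrite in_take ?mem_postorder // Dlt.
Qed.

End Coupling.
End Postorder.

(** * The search mechanism on a social network *)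

Section Network.
Variables (R : realType) (n : nat) (g : rel 'I_n).
Hypotheses (g_sym : symmetric g) (g_irr : irreflexive g).
Implicit Types (i j k y z d : 'I_n) (theta : 'I_n -> R) (T : profile g).

Lemma friend_neq y z : g y z -> y != z.
Proof. by apply: contraTneq => ->; rewrite g_irr. Qed.

Definition says T k y z := val (T k) y z == 1%R.

Lemma says_deviate T i (t : report g i) k : k != i ->
  says (deviate T t) k =2 says T k.
Proof. by move=> ki y z; rewrite /says /deviate ffunE dfwith_out // eq_sym. Qed.

Lemma says_truth theta T k y z : generated_by theta T ->
  observes g k y z -> says T k y z = (theta z < theta y)%R.
Proof.
by move=> gen obs; rewrite /says gen // sgz_cp0 subr_gt0.
Qed.

Lemma says_observes T k y z : says T k y z -> observes g k y z.
Proof.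
move=> /eqP kyz; have /forallP/(_ y)/forallP/(_ z)/and3P[_ _ /eqP<-] := valP (T k).
by rewrite kyz.
Qed.

Definition common_friend y z := [pick k | g y k && g z k].

(** A majority of [y], [z] and a common friend. The default [y] is a dummy: in a supported network
    every link has a common friend. *)
Definition link_above T y z :=
  let a := says T y y z in let b := says T z y z in
  let c := says T (odflt y (common_friend y z)) y z in
  g y z && [|| a && b, a && c | b && c].

(* The relay [d] is only trusted on pairs lying on the same side of it; if it
   lies between [y] and [z], their comparison follows from two links. *)
Definition relay_above T y z :=
  [&& ~~ g y z, y != z &
      if common_friend y z is Some d
      then says T d y z && (link_above T d y == link_above T d z) else false].

Definition children T y : seq 'I_n :=
  [seq z <- enum 'I_n | link_above T y z] ++
  [seq z <- enum 'I_n | relay_above T y z].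

Lemma mem_children T y z :
  (z \in children T y) = link_above T y z || relay_above T y z.
Proof. by rewrite mem_cat mem_filter mem_enum mem_filter mem_enum !andbT. Qed.

Lemma index_finish_lt T y : index y (postorder (children T)) < n.
Proof.
rewrite -[X in _ < X]card_ord -(size_postorder (children T)) index_mem.
exact: mem_postorder.
Qed.

Definition finish_rank T y : 'I_n := Ordinal (index_finish_lt T y).

Lemma finish_rank_inj T : injective (finish_rank T).
Proof.
move=> y z /(congr1 val) /= eq_yz.
by rewrite -(nth_index y (mem_postorder (children T) y)) eq_yz nth_index ?mem_postorder.
Qed.

Definition dfs_mechanism : mechanism g := fun T => perm (@finish_rank_inj T).

Lemma rank_dfs T y : rank dfs_mechanism T y = (index y (postorder (children T))).+1.
Proof. by rewrite /rank permE. Qed.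

Section Supported.
Hypothesis supported : forall i j, g i j -> exists k, g i k /\ g j k.

Lemma common_friend_link y z : g y z -> exists k,
  [/\ common_friend y z = Some k, g y k, g z k, k != y & k != z].
Proof.
move=> /supported[k0 [yk0 zk0]]; rewrite /common_friend.
case: pickP => [k /andP[yk zk]|/(_ k0)]; last by rewrite yk0 zk0.
by exists k; rewrite ![k == _]eq_sym !friend_neq.
Qed.

Lemma link_above_truth theta T y z : generated_by theta T ->
  g y z -> link_above T y z = (theta z < theta y)%R.
Proof.
move=> gen yz; have [k [kE yk zk _ _]] := common_friend_link yz.
have nyz := friend_neq yz.
rewrite /link_above yz kE /= !(says_truth gen) /observes ?nyz ?eqxx ?yz ?orbT //.
- by case: ltP.
- by rewrite g_sym yk orbT g_sym zk orbT.
- by rewrite g_sym yz orbT.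
Qed.

Lemma link_above_friend T y z : link_above T y z -> g y z.
Proof. by case/andP. Qed.

(** * Efficiency and incentive compatibility at a truthful profile *)

Section Truthful.
Variables (theta : 'I_n -> R) (T : profile g).
Hypotheses (theta_inj : injective theta) (gen : generated_by theta T).

(* Two of the three witnesses of a link are sincere. *)
Lemma link_above_deviate i (t : report g i) y z :
  link_above (deviate T t) y z = link_above T y z.
Proof.
have [yz|] := boolP (g y z); last by rewrite /link_above => /negPf->.
rewrite (link_above_truth gen yz).
have [k [kE yk zk ky kz]] := common_friend_link yz.
have yz_neq := friend_neq yz.
have dev j : j != i -> observes g j y z ->
    says (deviate T t) j y z = (theta z < theta y)%R.
  by move=> ji obs; rewrite says_deviate // (says_truth gen).
have obs_y : observes g y y z by rewrite /observes yz_neq eqxx yz orbT.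
have obs_z : observes g z y z by rewrite /observes yz_neq eqxx g_sym yz orbT.
have obs_k : observes g k y z.
  by rewrite /observes yz_neq g_sym yk orbT g_sym zk orbT.
rewrite /link_above yz kE /=.
have [iy|yi] := eqVneq y i.
  rewrite (dev z) ?(dev k) //; try by rewrite -iy // eq_sym.
  by case: (theta z < theta y)%R; rewrite ?andbF ?orbT.
rewrite (dev y) //; have [iz|zi] := eqVneq z i.
  rewrite (dev k) //; last by rewrite -iz.
  by case: (theta z < theta y)%R; rewrite ?andbF ?orbT.
rewrite (dev z) //.
by case: (theta z < theta y)%R.
Qed.

Lemma relay_above_deviate i (t : report g i) y z :
  common_friend y z != Some i ->
  relay_above (deviate T t) y z = relay_above T y z.
Proof.
rewrite /relay_above; case: (common_friend y z) => // d di.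
by rewrite !link_above_deviate says_deviate.
Qed.

Lemma common_friend_friends y z d : common_friend y z = Some d ->
  g d y /\ g d z.
Proof.
rewrite /common_friend; case: pickP => // k /andP[yk zk] [<-].
by rewrite g_sym yk g_sym zk.
Qed.

Lemma children_lt y z : z \in children T y -> (theta z < theta y)%R.
Proof.
rewrite mem_children => /orP[lk|].
  by rewrite -(link_above_truth gen) // (link_above_friend lk).
case/and3P => _ yz; case E: (common_friend y z) => [d|//] /andP[dyz _].
by rewrite -(says_truth gen (says_observes dyz)).
Qed.

Lemma index_children_lt y z : z \in children T y ->
  index z (postorder (children T)) < index y (postorder (children T)).
Proof.
apply: (postorder_topological (lt := fun a b => (theta a < theta b)%R)).
- by move=> a; rewrite ltxx.
- by move=> a b c; apply: lt_trans.
- exact: children_lt.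
- exact: mem_postorder.
Qed.

Lemma index_reported_above y z : reported_above T y z ->
  index z (postorder (children T)) < index y (postorder (children T)).
Proof.
case/existsP => k kyz; have obs := says_observes kyz.
have tzy : (theta z < theta y)%R by rewrite -(says_truth gen obs).
have [yz|nyz] := boolP (g y z).
  by apply: index_children_lt; rewrite mem_children (link_above_truth gen yz) tzy.
have [ky kz] : g y k /\ g z k.
  have /and3P[neq_yz /orP[/eqP yk|ky] /orP[/eqP zk|kz]] := obs.
  + by rewrite yk zk eqxx in neq_yz.
  + by rewrite yk kz in nyz.
  + by rewrite zk g_sym ky in nyz.
  + by rewrite g_sym ky g_sym kz.
(* The observer [k] need not be the relay [d], but [d] sees the same pair and is sincere. *)
have [d dE] : exists d, common_friend y z = Some d.
  rewrite /common_friend; case: pickP => [d _|/(_ k)]; first by exists d.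
  by rewrite ky kz.
have [dy dz] := common_friend_friends dE.
have neq_yz : y != z by case/and3P: obs.
have obs_d : observes g d y z by rewrite /observes neq_yz dy dz !orbT.
have [same|] := boolP (link_above T d y == link_above T d z).
  apply: index_children_lt; rewrite mem_children /relay_above nyz neq_yz dE.
  by rewrite (says_truth gen obs_d) tzy same orbT.
rewrite !(link_above_truth gen) // => side.
have [tdy tzd] : (theta d < theta y)%R /\ (theta z < theta d)%R.
  have neq_yd : theta y != theta d.
    by rewrite (inj_eq theta_inj) eq_sym friend_neq.
  move: side; case: (ltgtP (theta y) (theta d)) neq_yd => // [tyd|tdy] _.
    by rewrite (lt_trans tzy tyd).
  by case: ltP.
apply: (@ltn_trans (index d (postorder (children T)))).
  by apply: index_children_lt; rewrite mem_children (link_above_truth gen dz) tzd.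
apply: index_children_lt; rewrite mem_children (@link_above_truth theta) //.
  by rewrite tdy.
by rewrite g_sym.
Qed.

Lemma index_induced_order y z : induced_order T y z ->
  index z (postorder (children T)) < index y (postorder (children T)).
Proof.
case=> p; elim: p y => [|x p IHp] y /=.
  by rewrite andbT; apply: index_reported_above.
by case/andP => /index_reported_above xy /IHp zx; apply: ltn_trans xy.
Qed.

(** This is the set [D] of the coupling: the proper descendants of [i] in the truthful search
    graph. *)
Definition below i y := (y != i) && connect (fun a b => b \in children T a) i y.

Lemma connect_children_le a b : connect (fun a b => b \in children T a) a b ->
  (theta b <= theta a)%R.
Proof.
case/connectP => p pth ->; elim: p a pth => //= c p IHp a /andP[ca /IHp].
by move/le_trans; apply; apply/ltW/children_lt.
Qed.

Lemma below_lt i y : below i y -> (theta y < theta i)%R.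
Proof.
case/andP => neq /connect_children_le; rewrite le_eqVlt (inj_eq theta_inj).
by rewrite (negPf neq).
Qed.

Lemma below_children i y z : (y == i) || below i y -> z \in children T y ->
  below i z.
Proof.
move=> yi zy; have con : connect (fun a b => b \in children T a) i y.
  by case/orP: yi => [/eqP->|/andP[]].
apply/andP; split; last exact/(connect_trans con)/connect1.
have := lt_le_trans (children_lt zy) (connect_children_le con).
by apply: contraTneq => ->; rewrite ltxx.
Qed.

Lemma index_below i y : below i y ->
  index y (postorder (children T)) < index i (postorder (children T)).
Proof.
case/andP => + /connectP[p]; elim: p i => /= [|c p IHp] i yi.
  by move=> _ yE; rewrite yE eqxx in yi.
case/andP => ci cp yE; have lt_c := index_children_lt ci.
have [->//|yc] := eqVneq y c.
exact: ltn_trans (IHp c yc cp yE) lt_c.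
Qed.

Lemma rank_deviate i (t : report g i) :
  rank dfs_mechanism (deviate T t) i <= rank dfs_mechanism T i.
Proof.
rewrite !rank_dfs ltnS.
have chE z y : z \in children (deviate T t) y -> z \in children T y \/
    [/\ common_friend y z = Some i &
        link_above T i y == link_above T i z].
  rewrite !mem_children link_above_deviate.
  have [friend_i|] := eqVneq (common_friend y z) (Some i); last first.
    by move/relay_above_deviate->; left.
  case/orP => [->|]; first by left.
  case/and3P => _ _; rewrite friend_i => /andP[_].
  by rewrite !link_above_deviate; right.
apply: (index_postorder_le (D := below i)).
- by rewrite /below eqxx.
- by move=> y z yi; apply: below_children; rewrite yi orbT.
- move=> y z yi /chE[|[friend_i]]; first by apply: below_children; rewrite yi orbT.
  (* As [y] is below [i], the same-side test puts [z] below [i] too, so the deviation cannot lead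
     out of [below i]. *)
  have [iy iz] := common_friend_friends friend_i.
  rewrite (link_above_truth gen iy) below_lt // => /eqP/esym lk.
  by apply: (@below_children i i); rewrite ?eqxx // mem_children lk.
- by move=> z; apply: below_children; rewrite eqxx.
- move=> z /chE[|[/common_friend_friends[]]]; last by rewrite g_irr.
  by apply: below_children; rewrite eqxx.
- move=> y yi nbelow; rewrite /children.
  have -> : [seq z <- enum 'I_n | link_above (deviate T t) y z] =
            [seq z <- enum 'I_n | link_above T y z].
    by apply: eq_filter => z; rewrite link_above_deviate.
  have [yi_lk|] := boolP (i \in [seq z <- enum 'I_n | link_above T y z]).
    by right; do 3 eexists; split; first reflexivity; first reflexivity.
  (* Here [i] relays nothing for [y]: otherwise [y] and [i] would be linked, and [i] not being below
     [y] would put [y] below [i]. *)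
  rewrite mem_filter mem_enum andbT => nlk; left; congr (_ ++ _).
  apply: eq_filter => z; rewrite relay_above_deviate //.
  apply: contra nlk => /eqP/common_friend_friends[iy _].
  have yg : g y i by rewrite g_sym.
  rewrite (link_above_truth gen yg) ltNge le_eqVlt (inj_eq theta_inj).
  rewrite (negPf yi) /=; apply: contra nbelow => tyi.
  by apply: (@below_children i i); rewrite ?eqxx // mem_children (link_above_truth gen iy) tyi.
- by move=> y; apply: index_below.
Qed.

End Truthful.

End Supported.

(** * Truthful profiles and the necessity of common friends *)

Section TruthfulProfile.
Variables (theta : 'I_n -> R) (theta_inj : injective theta).

Definition truth_mx k : 'M[int]_n :=
  \matrix_(y, z) if observes g k y z then sgz (theta y - theta z)%R else 0%R.

Lemma truth_mx_admissible k : admissible g k (truth_mx k).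
Proof.
apply/forallP => y; apply/forallP => z; rewrite !mxE.
have -> : observes g k z y = observes g k y z.
  by rewrite /observes eq_sym; congr (_ && _); rewrite andbC.
case obs: (observes g k y z); last by rewrite oppr0 !eqxx.
rewrite -sgzN opprB eqxx sgz_eq0 subr_eq0 (inj_eq theta_inj).
have /andP[-> _] := obs; rewrite andbT !inE.
by case: sgzP.
Qed.

Definition truth_profile : profile g :=
  [ffun k => exist _ (truth_mx k) (truth_mx_admissible k)].

Lemma truth_profileE k : val (truth_profile k) = truth_mx k.
Proof. by rewrite ffunE. Qed.

Lemma truth_generated : generated_by theta truth_profile.
Proof. by move=> k y z obs; rewrite truth_profileE mxE obs. Qed.

End TruthfulProfile.

(** Take the length of a shortest walk from [i]; dropping its last step gives a closer friend. *)
Lemma distance_decreasing i : (forall y, connect g i y) ->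
  exists dist : 'I_n -> nat, forall y, y != i ->
    exists2 z, g y z & dist z < dist y.
Proof.
move=> con; pose reach (k : nat) y := [exists p : k.-tuple 'I_n, path g i p && (last i p == y)].
have reach_ex y : exists k : nat, reach k y.
  have /connectP[p pth ->] := con y; exists (size p).
  by apply/existsP; exists (in_tuple p); rewrite pth eqxx.
exists (fun y => ex_minn (reach_ex y)) => y yi.
case: (ex_minnP (reach_ex y)) => m /existsP[p /andP[pth /eqP py]] _.
case/lastP: (val p) (size_tuple p) pth py => [_ _ /= iy|q x sz].
  by rewrite iy eqxx in yi.
rewrite rcons_path last_rcons => /andP[pth lx] xy; rewrite -{}xy in yi *.
exists (last i q); first by rewrite g_sym.
case: ex_minnP => k _ min_k; rewrite -sz size_rcons ltnS; apply: min_k.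
by apply/existsP; exists (in_tuple q); rewrite pth eqxx.
Qed.

(** Descending from friend to lower friend can only stop at [i], so efficiency puts everyone else
    above [i], and nobody else can fill rank 1. *)
Lemma rank_lowest (rho : mechanism g) (h : 'I_n -> nat) T i :
  ex_post_efficient R rho -> injective h ->
  generated_by (fun y => (h y)%:R%R : R) T ->
  (forall y, y != i -> exists2 z, g y z & h z < h y) ->
  rank rho T i = 1.
Proof.
move=> eff h_inj gen lower.
have above y z : g y z -> h z < h y -> reported_above T y z.
  move=> yz lt_zy; apply/existsP; exists y.
  have := @says_truth _ T y y z gen; rewrite /says => -> //.
    by rewrite ltr_nat.
  by rewrite /observes friend_neq // eqxx yz orbT.
have type_T : type_vector R T.
  exists (fun y => (h y)%:R%R) => // y z /eqP; rewrite eqr_nat => /eqP.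
  exact: h_inj.
have lt_i y : y != i -> rank rho T i < rank rho T y.
  move=> yi; apply: eff => //; move: yi.
  have [m] := ubnP (h y); elim: m y => // m IHm y ltym yi.
  have [z yz lt_zy] := lower y yi; have yz_above := above y z yz lt_zy.
  have [zi|zi] := eqVneq z i; first by exists [::]; rewrite /= -zi yz_above.
  have [|//|p pth] := IHm z; first exact: leq_trans lt_zy _.
  by exists (z :: p); rewrite /= yz_above.
have n_gt0 : 0 < n by case: (n) i {lt_i lower} => [[]|].
pose y := (rho T)^-1%g (Ordinal n_gt0).
have rank_y : rank rho T y = 1 by rewrite /rank permKV.
have [<-//|/lt_i] := eqVneq y i; by rewrite rank_y.
Qed.

Lemma supported_of_mechanism (rho : mechanism g) :
    (forall i j, connect g i j) ->
    ex_post_IC R rho -> ex_post_efficient R rho ->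
  forall i j, g i j -> exists k, g i k /\ g j k.
Proof.
move=> con IC eff i j ij.
have [/existsP[k /andP[]]|/existsPn no_common] := boolP [exists k, g i k && g j k].
  by exists k.
have ji : j != i by rewrite eq_sym friend_neq.
have [dist distP] := distance_decreasing (con i).
(* The distance dominates and [y < n] breaks ties, so [h] is injective and a closer friend is lower;
   the shift by 2 reserves 0 and 1 for [i] and [j]. *)
pose h y : nat := if y == i then 0 else if y == j then 1 else dist y * n + y + 2.
have h_inj : injective h.
  move=> y z; rewrite /h !addn2.
  case: (eqVneq y i) => [->|_]; case: (eqVneq z i) => [->|_] //;
    [by case: ifP | by case: ifP |].
  case: (eqVneq y j) => [->|_]; case: (eqVneq z j) => [->|_] //.
  by case=> /(congr1 (modn^~ n)); rewrite !modnMDl !modn_small // => /val_inj.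
have h_gt1 y : y != i -> y != j -> 1 < h y.
  by move=> /negPf yi /negPf yj; rewrite /h yi yj addn2.
have h_i : h i = 0 by rewrite /h eqxx.
have h_j : h j = 1 by rewrite /h (negPf ji) eqxx.
have lower y : y != i -> exists2 z, g y z & h z < h y.
  move=> yi; have [->|yj] := eqVneq y j.
    by exists i; rewrite ?h_i ?h_j // g_sym.
  have [z yz lt_zy] := distP y yi; exists z => //.
  rewrite {1}/h; case: eqP => _; first exact: ltn_trans (h_gt1 y yi yj).
  case: eqP => _; first exact: h_gt1.
  rewrite /h (negPf yi) (negPf yj) ltn_add2r.
  apply: (@leq_trans ((dist z).+1 * n)); first by rewrite mulSn addnC ltn_add2r.
  by apply: leq_trans (leq_addr _ _); rewrite leq_mul2r lt_zy orbT.
pose h' y := h (tperm i j y).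
have h'_inj : injective h' by move=> y z /h_inj/perm_inj.
have h'E y : y != i -> y != j -> h' y = h y.
  by move=> yi yj; rewrite /h' tpermD // eq_sym.
have lower' y : y != j -> exists2 z, g y z & h' z < h' y.
  move=> yj; have [->|yi] := eqVneq y i.
    by exists j => //; rewrite /h' tpermL tpermR h_i h_j.
  have [z yz lt_zy] := lower y yi; exists z => //; rewrite (h'E y) // /h'.
  case: tpermP => [_|_|//]; first by rewrite h_j h_gt1.
  by rewrite h_i (ltn_trans _ (h_gt1 y yi yj)).
have natR_inj (f : 'I_n -> nat) : injective f -> injective (fun y => (f y)%:R%R : R).
  by move=> f_inj y z /eqP; rewrite eqr_nat => /eqP/f_inj.
pose T := truth_profile (natR_inj h h_inj).
pose T' := truth_profile (natR_inj h' h'_inj).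
have type_T : type_vector R T.
  by exists (fun y => (h y)%:R%R); [exact/natR_inj | exact: truth_generated].
have type_T' : type_vector R T'.
  by exists (fun y => (h' y)%:R%R); [exact/natR_inj | exact: truth_generated].
have rank_i : rank rho T i = 1.
  by apply: (rank_lowest eff h_inj) lower; exact: truth_generated.
have rank_j : rank rho T' j = 1.
  by apply: (rank_lowest eff h'_inj) lower'; exact: truth_generated.
have sgz_nat (f : 'I_n -> nat) y z : injective f -> y != z ->
    sgz ((f y)%:R - (f z)%:R : R)%R = (if (f z < f y)%N then 1 else -1)%R.
  move=> f_inj; rewrite -(inj_eq f_inj).
  case: ltngtP => // lt_f _; last by rewrite ltr0_sgz // subr_lt0 ltr_nat.
  by rewrite gtr0_sgz // subr_gt0 ltr_nat.
(* Exchanging the two lowest values alters only the comparison of [i] with [j], which such a [k]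
   could observe only as a common friend. *)
have TT' k : k != i -> k != j -> T k = T' k.
  move=> ki kj; apply: val_inj; rewrite !truth_profileE.
  apply/matrixP => y z; rewrite !mxE; case: ifP => // /and3P[yz ky kz].
  rewrite !sgz_nat //; suff -> : (h' z < h' y) = (h z < h y) by [].
  have low_friend x : (x == i) || (x == j) -> (x == k) || g k x -> g x k.
    move=> xij; rewrite (negPf (_ : x != k)) /= 1?g_sym //.
    by case/orP: xij => /eqP->; rewrite eq_sym.
  have low_le x : (x == i) || (x == j) -> h x <= 1 /\ h' x <= 1.
    by case/orP => /eqP->; rewrite /h' ?tpermL ?tpermR h_i h_j.
  have high_gt x : ~~ ((x == i) || (x == j)) -> h' x = h x /\ 1 < h x.
    by case/norP => xi xj; rewrite h'E // h_gt1.
  have [y_low|/high_gt[-> hy]] := boolP ((y == i) || (y == j));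
    have [z_low|/high_gt[-> hz]] := boolP ((z == i) || (z == j)) => //.
  - have := no_common k; move: (low_friend y y_low ky) (low_friend z z_low kz) yz.
    by case/orP: y_low => /eqP->; case/orP: z_low => /eqP-> yk zk;
       rewrite ?eqxx // yk zk.
  - by have [y1 y1'] := low_le y y_low; rewrite !ltnNge !(leq_trans _ (ltnW hz)).
  - by have [z1 z1'] := low_le z z_low; rewrite !(leq_ltn_trans _ hy).
(* Both sides consist of the report of [i] from [T'], that of [j] from [T], and the shared reports
   of the others. *)
have same : deviate T (T' i) = deviate T' (T j).
  apply/ffunP => k; rewrite [LHS]ffunE [RHS]ffunE.
  have [->|kj] := eqVneq k j.
    by rewrite dfwith_in dfwith_out // eq_sym.
  have [->|ki] := eqVneq k i; first by rewrite dfwith_in dfwith_out.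
  by rewrite !dfwith_out ?TT' // eq_sym.
have := IC T type_T i (T' i); have := IC T' type_T' j (T j).
rewrite rank_i rank_j -same !ltnS !leqn0 => /eqP rj /eqP ri.
by move: ji; rewrite -(inj_eq (@perm_inj _ (rho (deviate T (T' i))))) -val_eqE /= rj ri.
Qed.

End Network.

Theorem theorem4 (R : realType) (n : nat) (g : rel 'I_n)
    (g_sym : symmetric g) (g_irr : irreflexive g)
    (g_connected : forall i j : 'I_n, connect g i j) :
  (exists rho : mechanism g, ex_post_IC R rho /\ ex_post_efficient R rho) <->
  (forall i j : 'I_n, g i j -> exists k : 'I_n, g i k /\ g j k).
Proof.
split=> [[rho [IC eff]]|supported]; first exact: supported_of_mechanism IC eff.
exists (@dfs_mechanism n g); split=> T [theta theta_inj gen].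
  by move=> i t; apply: (rank_deviate g_sym g_irr supported theta_inj gen).
move=> i j ij; rewrite !rank_dfs ltnS.
exact: (index_induced_order g_sym g_irr supported theta_inj gen).
Qed.
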